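(* Let $\gamma>0$. A left slice hyperholomorphic function $f:\mathbb{H}\to\mathbb{H}$ belongs to the slice hyperholomorphic RBF space $\mathcal{H}_{\gamma,S}(\mathbb{H})$ if and only if there exists a unique function $g$ in the slice hyperholomorphic Fock space $\mathcal{F}_{Slice}^{\frac{2}{\gamma^2}}(\mathbb{H})$ such that $$f(q)=e^{-\frac{q^2}{\gamma^2}}g(q),\qquad \forall q\in\mathbb{H}.$$ Furthermore, an isometric isomorphism between the spaces $\mathcal{H}_{\gamma,S}(\mathbb{H})$ and $\mathcal{F}_{Slice}^{\frac{2}{\gamma^2}}(\mathbb{H})$ is given by $$\mathcal{M}^{\gamma^2}[f](q)=e^{\frac{q^2}{\gamma^2}}f(q),\qquad \forall f\in\mathcal{H}_{\gamma,S}(\mathbb{H}),\ q\in\mathbb{H}.$$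
   Context: $\mathbb{H}$ denotes the real quaternions, with conjugation $q\mapsto\bar q$ and modulus $|q|$; $\mathbb{S}=\{I\in\mathbb{H}: I^2=-1\}$; for $I\in\mathbb{S}$, $\mathbb{C}_I=\mathbb{R}+I\mathbb{R}$; every $q\in\mathbb{H}$ is of the form $q=x+Iy$ with $x,y\in\mathbb{R}$, $I\in\mathbb{S}$. The exponential of a quaternion is defined by the usual power series. A function $f:\mathbb{H}\to\mathbb{H}$ is left slice hyperholomorphic, written $f\in\mathcal{SH}_L(\mathbb{H})$, if $f(x+Iy)=\alpha(x,y)+I\beta(x,y)$ for all $x,y\in\mathbb{R}$, $I\in\mathbb{S}$, where $\alpha,\beta:\mathbb{R}^2\to\mathbb{H}$ satisfy $\alpha(x,-y)=\alpha(x,y)$, $\beta(x,-y)=-\beta(x,y)$ and the Cauchy-Riemann system $\partial_x\alpha-\partial_y\beta=0$, $\partial_y\alpha+\partial_x\beta=0$. Write $f_I=f|_{\mathbb{C}_I}$ and $d\lambda_I(q)=dx\,dy$ for $q=x+Iy$. For $\gamma>0$, the slice hyperholomorphic RBF space $\mathcal{H}_{\gamma,S}(\mathbb{H})$ is the right quaternionic vector space of all $f\in\mathcal{SH}_L(\mathbb{H})$ with $$\|f\|_{\mathcal{H}_{\gamma,S}(\mathbb{H})}^2=\frac{2}{\pi\gamma^2}\int_{\mathbb{C}_I}|f_I(q)|^2e^{\frac{(q-\bar q)^2}{\gamma^2}}d\lambda_I(q)<\infty ,$$ with inner product $\langle f,g\rangle_{\mathcal{H}_{\gamma,S}(\mathbb{H})}=\frac{2}{\pi\gamma^2}\int_{\mathbb{C}_I}\overline{g_I(q)}f_I(q)e^{\frac{(q-\bar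 q)^2}{\gamma^2}}d\lambda_I(q)$. For $\nu>0$, the slice hyperholomorphic Fock space $\mathcal{F}^{\nu}_{Slice}(\mathbb{H})$ is the right quaternionic Hilbert space of all $f\in\mathcal{SH}_L(\mathbb{H})$ with $$\|f\|^2_{\mathcal{F}^{\nu}_{Slice}(\mathbb{H})}=\frac{\nu}{\pi}\int_{\mathbb{C}_I}|f_I(q)|^2e^{-\nu|q|^2}d\lambda_I(q)<\infty,$$ with inner product $\langle f,g\rangle=\frac{\nu}{\pi}\int_{\mathbb{C}_I}\overline{g_I(q)}f_I(q)e^{-\nu|q|^2}d\lambda_I(q)$. Neither space depends on the choice of $I\in\mathbb{S}$. *)

(* Defs.v *)
From HB Require Import structures.
From mathcomp Require Import all_boot all_order all_algebra.
From mathcomp Require Import all_classical all_reals all_analysis.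
From mathcomp Require Import ring lra.

Set Implicit Arguments.
Unset Strict Implicit.
Unset Printing Implicit Defensive.

Import Order.TTheory GRing.Theory Num.Theory.
Import numFieldNormedType.Exports.

Local Open Scope classical_set_scope.
Local Open Scope ring_scope.

(* [Quat a b c d] is a + b i + c j + d k. *)
Record quat (R : realType) := Quat { qre : R; qi : R; qj : R; qk : R }.

Section QuatAlgebra.
Variable R : realType.
Implicit Types (a b : R) (p q r : quat R).

Definition tuple_of_quat q : R * R * R * R := (qre q, qi q, qj q, qk q).
Definition quat_of_tuple (t : R * R * R * R) : quat R :=
  Quat t.1.1.1 t.1.1.2 t.1.2 t.2.

Lemma tuple_of_quatK : cancel tuple_of_quat quat_of_tuple.
Proof. by case. Qed.

HB.instance Definition _ := Choice.copy (quat R) (can_type tuple_of_quatK).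

Definition qadd p q :=
  Quat (qre p + qre q) (qi p + qi q) (qj p + qj q) (qk p + qk q).
Definition qopp q := Quat (- qre q) (- qi q) (- qj q) (- qk q).
Definition qmul p q :=
  Quat (qre p * qre q - qi p * qi q - qj p * qj q - qk p * qk q)
       (qre p * qi q + qi p * qre q + qj p * qk q - qk p * qj q)
       (qre p * qj q - qi p * qk q + qj p * qre q + qk p * qi q)
       (qre p * qk q + qi p * qj q - qj p * qi q + qk p * qre q).
Definition qscale a q := Quat (a * qre q) (a * qi q) (a * qj q) (a * qk q).

Lemma qaddA : associative qadd.
Proof. by move=> [? ? ? ?] [? ? ? ?] [? ? ? ?]; congr Quat => /=; ring. Qed.
Lemma qaddC : commutative qadd.
Proof. by move=> [? ? ? ?] [? ? ? ?]; congr Quat => /=; ring. Qed.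
Lemma qadd0 : left_id (Quat 0 0 0 0) qadd.
Proof. by move=> [? ? ? ?]; congr Quat => /=; ring. Qed.
Lemma qaddN : left_inverse (Quat 0 0 0 0) qopp qadd.
Proof. by move=> [? ? ? ?]; congr Quat => /=; ring. Qed.

HB.instance Definition _ :=
  GRing.isZmodule.Build (quat R) qaddA qaddC qadd0 qaddN.

Lemma qmulA : associative qmul.
Proof. by move=> [? ? ? ?] [? ? ? ?] [? ? ? ?]; congr Quat => /=; ring. Qed.
Lemma qmul1 : left_id (Quat 1 0 0 0) qmul.
Proof. by move=> [? ? ? ?]; congr Quat => /=; ring. Qed.
Lemma qmulr1 : right_id (Quat 1 0 0 0) qmul.
Proof. by move=> [? ? ? ?]; congr Quat => /=; ring. Qed.
Lemma qmulDl : left_distributive qmul +%R.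
Proof. by move=> [? ? ? ?] [? ? ? ?] [? ? ? ?]; congr Quat => /=; ring. Qed.
Lemma qmulDr : right_distributive qmul +%R.
Proof. by move=> [? ? ? ?] [? ? ? ?] [? ? ? ?]; congr Quat => /=; ring. Qed.
Lemma qone_neq0 : Quat 1 0 0 0 != 0 :> quat R.
Proof. by apply/eqP => -[] /eqP; rewrite oner_eq0. Qed.

HB.instance Definition _ := GRing.Zmodule_isNzRing.Build (quat R)
  qmulA qmul1 qmulr1 qmulDl qmulDr qone_neq0.

Lemma qscaleA a b q : qscale a (qscale b q) = qscale (a * b) q.
Proof. by congr Quat => /=; ring. Qed.
Lemma qscale1 : left_id 1 qscale.
Proof. by move=> [? ? ? ?]; congr Quat => /=; ring. Qed.
Lemma qscaleDr : right_distributive qscale +%R.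
Proof. by move=> ? [? ? ? ?] [? ? ? ?]; congr Quat => /=; ring. Qed.
Lemma qscaleDl q : {morph qscale^~ q : a b / a + b}.
Proof. by move=> a b; congr Quat => /=; ring. Qed.

HB.instance Definition _ := GRing.Zmodule_isLmodule.Build R (quat R)
  qscaleA qscale1 qscaleDr qscaleDl.

Lemma qscaleAl a p q : a *: (p * q) = (a *: p) * q.
Proof. by congr Quat => /=; ring. Qed.
Lemma qscaleAr a p q : a *: (p * q) = p * (a *: q).
Proof. by congr Quat => /=; ring. Qed.

HB.instance Definition _ := GRing.Lmodule_isLalgebra.Build R (quat R) qscaleAl.
HB.instance Definition _ := GRing.Lalgebra_isAlgebra.Build R (quat R) qscaleAr.

Definition qconj q := Quat (qre q) (- qi q) (- qj q) (- qk q).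

Definition qmodulus q :=
  Num.sqrt (qre q ^+ 2 + qi q ^+ 2 + qj q ^+ 2 + qk q ^+ 2).

Lemma ler_qmodulusD p q : qmodulus (p + q) <= qmodulus p + qmodulus q.
Proof.
case: p q => [a b c d] [x y z t]; rewrite /qmodulus /=.
set P := (X in Num.sqrt X + _); set Q := (X in _ <= _ + Num.sqrt X).
have P0 : 0 <= P by rewrite /P !addr_ge0 ?sqr_ge0.
have Q0 : 0 <= Q by rewrite /Q !addr_ge0 ?sqr_ge0.
have CS : a * x + b * y + c * z + d * t <= Num.sqrt P * Num.sqrt Q.
  rewrite -sqrtrM//; apply: le_trans (ler_norm _) _.
  rewrite -sqrtr_sqr ler_wsqrtr//.
  rewrite -subr_ge0.
  suff -> : P * Q - (a * x + b * y + c * z + d * t) ^+ 2 =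
    (a * y - b * x) ^+ 2 + (a * z - c * x) ^+ 2 + (a * t - d * x) ^+ 2 +
    (b * z - c * y) ^+ 2 + (b * t - d * y) ^+ 2 + (c * t - d * z) ^+ 2.
    by rewrite !addr_ge0 ?sqr_ge0.
  by rewrite /P /Q; ring.
have S0 : 0 <= Num.sqrt P + Num.sqrt Q by rewrite addr_ge0 ?sqrtr_ge0.
rewrite -[leRHS]ger0_norm// -sqrtr_sqr ler_wsqrtr// [leRHS]sqrrD !sqr_sqrtr//.
rewrite /P /Q in CS *; lra.
Qed.

Lemma qmodulusZ a q : qmodulus (a *: q) = `|a| * qmodulus q.
Proof.
rewrite /qmodulus -sqrtr_sqr -sqrtrM ?sqr_ge0//; congr Num.sqrt => /=; ring.
Qed.

Lemma qmodulus0_eq0 q : qmodulus q = 0 -> q = 0.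
Proof.
case: q => a b c d /eqP; rewrite /qmodulus sqrtr_eq0 /= => H.
have ha := sqr_ge0 a; have hb := sqr_ge0 b.
have hc := sqr_ge0 c; have hd := sqr_ge0 d.
by congr Quat; apply/eqP; rewrite -sqrf_eq0; apply/eqP; lra.
Qed.

(* `|q| is the modulus of q, and the topology of [quat R] is the one it
   induces. *)
HB.instance Definition _ := Lmodule_isNormed.Build R (quat R)
  ler_qmodulusD qmodulusZ qmodulus0_eq0.

Definition qexp q : quat R :=
  limn (series (fun n => (n`!%:R)^-1 *: q ^+ n)).

Definition imaginary_units : set (quat R) := [set I | I ^+ 2 = -1].

End QuatAlgebra.

Section SliceHyperholomorphic.
Variable R : realType.
Implicit Types (I : quat R) (f g : quat R -> quat R) (gamma nu : R).

(* The plane C_I, parametrised by R * R: (x, y) stands for x + I y. *)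
Definition slice I (p : R * R) : quat R := p.1%:A + p.2 *: I.

(* The components alpha, beta are real differentiable, so that the
   Cauchy-Riemann system expresses holomorphy. *)
Definition slice_hyperholomorphic f :=
  exists alpha beta : R * R -> quat R,
    [/\ forall I, imaginary_units I ->
          forall p, f (slice I p) = alpha p + I * beta p,
        forall x y, alpha (x, - y) = alpha (x, y),
        forall x y, beta (x, - y) = - beta (x, y),
        forall p, differentiable alpha p /\ differentiable beta p &
        forall p, 'D_(1, 0) alpha p - 'D_(0, 1) beta p = 0 /\
                  'D_(0, 1) alpha p + 'D_(1, 0) beta p = 0].

Definition plane_measure := (@lebesgue_measure R \x @lebesgue_measure R)%E.

Definition qintegral (F : R * R -> quat R) : quat R :=
  Quat (\int[plane_measure]_p qre (F p)) (\int[plane_measure]_p qi (F p))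
       (\int[plane_measure]_p qj (F p)) (\int[plane_measure]_p qk (F p)).

(* Squared norm and inner product attached to a weight w on C_I and to a
   normalising constant c. *)
Definition slice_norm2 c (w : quat R -> R) I f : \bar R :=
  (c%:E * \int[plane_measure]_p
            (`|f (slice I p)| ^+ 2 * w (slice I p))%:E)%E.

Definition slice_norm c w I f : R := Num.sqrt (fine (slice_norm2 c w I f)).

Definition slice_inner c (w : quat R -> R) I f g : quat R :=
  c *: qintegral (fun p => w (slice I p) *:
                           (qconj (g (slice I p)) * f (slice I p))).

Definition slice_space c w I : set (quat R -> quat R) :=
  [set f | slice_hyperholomorphic f /\ (slice_norm2 c w I f < +oo)%E].

(* (q - qbar)^2 is a real quaternion, hence so is its exponential. *)
Definition rbf_weight gamma (q : quat R) : R :=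
  qre (qexp ((gamma ^+ 2)^-1 *: (q - qconj q) ^+ 2)).
Definition rbf_const gamma : R := 2 / (pi * gamma ^+ 2).

Definition rbf_space gamma := slice_space (rbf_const gamma) (rbf_weight gamma).
Definition rbf_norm gamma := slice_norm (rbf_const gamma) (rbf_weight gamma).
Definition rbf_inner gamma := slice_inner (rbf_const gamma) (rbf_weight gamma).

Definition fock_weight nu (q : quat R) : R := expR (- (nu * `|q| ^+ 2)).

Definition fock_space nu := slice_space (nu / pi) (fock_weight nu).
Definition fock_norm nu := slice_norm (nu / pi) (fock_weight nu).
Definition fock_inner nu := slice_inner (nu / pi) (fock_weight nu).

(* Functions form a right vector space: (f a)(q) = f(q) a. *)
Definition isometric_isomorphism (A B : set (quat R -> quat R))
    (normA normB : (quat R -> quat R) -> R)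
    (innerA innerB : (quat R -> quat R) -> (quat R -> quat R) -> quat R)
    (M : (quat R -> quat R) -> quat R -> quat R) :=
  [/\ set_bij A B M,
      forall f g, A f -> A g ->
        M (fun q => f q + g q) = (fun q => M f q + M g q),
      forall f a, A f -> M (fun q => f q * a) = (fun q => M f q * a),
      forall f, A f -> normB (M f) = normA f &
      forall f g, A f -> A g -> innerB (M f) (M g) = innerA f g].

Definition rbf_mult gamma f : quat R -> quat R :=
  fun q => qexp ((gamma ^+ 2)^-1 *: q ^+ 2) * f q.

End SliceHyperholomorphic.

(* Main.v *)
(* Let E q = exp (q^2 / gamma^2). On the plane C_J it is the function
   exp (z^2 / gamma^2) of z = x + J y, with real components that do not depend
   on J and satisfy the Cauchy-Riemann equations; hence multiplication by E
   preserves left slice hyperholomorphy, and multiplication by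
   exp (- q^2 / gamma^2) inverts it. Since
     |E q|^2 exp (- 2 |q|^2 / gamma^2) = exp (- 4 y^2 / gamma^2)
                                       = exp ((q - qbar)^2 / gamma^2),
   the integrands defining both norms and both inner products agree pointwise.

   The closed form exp (a + J b) = e^a (cos b + J sin b) comes from comparing
   t |-> exp (t (a + i b)) with its Taylor polynomials on [0, 1]: the remainders
   satisfy r_(n+1)' = (a + i b) r_n and r_(n+1)(0) = 0, so by induction they are
   O (C^n t^n / n!). *)
From HB Require Import structures.
Require Import Defs.
From mathcomp Require Import all_boot all_order all_algebra.
From mathcomp Require Import all_classical all_reals all_analysis.
From mathcomp Require Import ring lra.
Import Order.TTheory GRing.Theory Num.Theory.
Import numFieldNormedType.Exports.
Local Open Scope classical_set_scope.
Local Open Scope ring_scope.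

(** * Growth bounds on [0, 1] from bounds on the derivative *)

Lemma le_of_derive_le_monomial (R : realType) (f df : R -> R) (K : R)
    (n : nat) :
  f 0 <= 0 -> (forall t : R, is_derive t (1 : R) f (df t)) ->
  (forall t : R, 0 <= t <= 1 -> df t <= K * t ^+ n / n`!%:R) ->
  forall t : R, 0 <= t <= 1 -> f t <= K * t ^+ n.+1 / n.+1`!%:R.
Proof.
move=> f0 fdf dfle t /andP[t0 t1].
pose m : {poly R} := (K / n.+1`!%:R) *: 'X^(n.+1).
have mE s : m.[s] = K * s ^+ n.+1 / n.+1`!%:R.
  by rewrite /m hornerZ hornerXn mulrAC.
have dmE s : m^`().[s] = K * s ^+ n / n`!%:R.
  rewrite /m derivZ derivXn hornerZ hornerMn hornerXn /= factS natrM.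
  have : n`!%:R != 0 :> R by rewrite pnatr_eq0 -lt0n fact_gt0.
  rewrite -mulr_natl; have : n.+1%:R != 0 :> R by rewrite pnatr_eq0.
  move=> ? ?; field; exact/andP.
have dg s : is_derive s (1 : R) (f - horner m) (df s - m^`().[s]).
  exact: is_deriveB.
(* [m] is the antiderivative, vanishing at 0, of the bound on [df], so [f - m] is nonincreasing on
   [0, 1]. *)
have : (f - horner m) t <= (f - horner m) 0.
  apply: (@ler0_derive1_le_cc _ _ 0 1).
  - by move=> s _; have := dg s => -[].
  - move=> s; rewrite in_itv /= => /andP[s0 s1].
    rewrite derive1E derive_val subr_le0 dmE.
    by apply: dfle; rewrite !ltW.
  - apply: continuous_subspaceT => s.
    apply: differentiable_continuous; apply/derivable1_diffP.
    by have := dg s => -[].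
  - by rewrite in_itv /= t0 t1.
  - by rewrite in_itv /= lexx ler01.
  - exact: t0.
rewrite /= !fctE /= !mE expr0n /= mulr0 mul0r subr0 => h.
by rewrite -subr_le0; apply: le_trans f0.
Qed.

Lemma norm_le_of_derive_le_monomial (R : realType) (f df : R -> R) (K : R)
    (n : nat) :
  f 0 = 0 -> (forall t : R, is_derive t (1 : R) f (df t)) ->
  (forall t : R, 0 <= t <= 1 -> `|df t| <= K * t ^+ n / n`!%:R) ->
  forall t : R, 0 <= t <= 1 -> `|f t| <= K * t ^+ n.+1 / n.+1`!%:R.
Proof.
move=> f0 fdf dfle t t01; rewrite ler_norml lerNl.
apply/andP; split.
  apply: (@le_of_derive_le_monomial R (- f) (- df)) => //.
    by rewrite fctE f0 oppr0.
  by move=> s /dfle; apply: le_trans; rewrite -normrN ler_norm.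
apply: (@le_of_derive_le_monomial R f df) => //; first by rewrite f0.
by move=> s /dfle; apply: le_trans; rewrite ler_norm.
Qed.

Lemma is_derive_mulr (R : realType) (c t : R) :
  is_derive t (1 : R) ( *%R^~ c) c.
Proof.
rewrite [X in is_derive _ _ X](_ : _ = horner (c *: 'X)).
  by apply: is_derive_eq; rewrite derivZ derivX hornerZ hornerC mulr1.
by apply/funext => s; rewrite hornerZ hornerX mulrC.
Qed.

(** Since J^2 = -1, C_J multiplies like the complex numbers, in coordinates that do not depend on
    J. *)
Lemma slice_mul (R : realType) (J : quat R) (s t : R * R) : imaginary_units J ->
  slice J s * slice J t =
  slice J (s.1 * t.1 - s.2 * t.2, s.1 * t.2 + s.2 * t.1).
Proof.
move=> J2; rewrite /slice /= mulrDl !mulrDr.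
rewrite -!scalerAl -!scalerAr !mul1r !mulr1 !scalerA -expr2 J2.
rewrite scalerN scalerBl scalerDl -!addrA; congr (_ + _).
by rewrite addrA addrC.
Qed.

Lemma scale_slice (R : realType) (J : quat R) (c : R) (s : R * R) :
  c *: slice J s = slice J (c * s.1, c * s.2).
Proof. by rewrite /slice scalerDr !scalerA. Qed.

(** * Closed form of the exponential on C_J *)

Section ComplexExponentialSeries.
Variables (R : realType) (a b : R).

(* Real and imaginary parts of (a + i b)^n. *)
Definition cpow (n : nat) : R * R :=
  iter n (fun z => (a * z.1 - b * z.2, a * z.2 + b * z.1)) (1, 0).

(* Partial sums of exp (t (a + i b)), as polynomials in t. *)
Definition cexp_re (n : nat) : {poly R} := \poly_(k < n) ((cpow k).1 / k`!%:R).
Definition cexp_im (n : nat) : {poly R} := \poly_(k < n) ((cpow k).2 / k`!%:R).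

(** Differentiation in t multiplies the partial sum by a + i b and drops its last term; this is the
    real part. *)
Lemma deriv_cexp_re n :
  (cexp_re n.+1)^`() = a *: cexp_re n - b *: cexp_im n.
Proof.
apply/polyP => k; rewrite coef_deriv coefB !coefZ !coef_poly ltnS.
case: ltnP => _; last by rewrite mul0rn !mulr0 subrr.
rewrite /= factS natrM -mulr_natl.
have : k`!%:R != 0 :> R by rewrite pnatr_eq0 -lt0n fact_gt0.
have : k.+1%:R != 0 :> R by rewrite pnatr_eq0.
by move=> ? ?; field; apply/andP.
Qed.

Lemma deriv_cexp_im n :
  (cexp_im n.+1)^`() = b *: cexp_re n + a *: cexp_im n.
Proof.
apply/polyP => k; rewrite coef_deriv coefD !coefZ !coef_poly ltnS.
case: ltnP => _; last by rewrite mul0rn !mulr0 addr0.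
rewrite /= factS natrM -mulr_natl.
have : k`!%:R != 0 :> R by rewrite pnatr_eq0 -lt0n fact_gt0.
have : k.+1%:R != 0 :> R by rewrite pnatr_eq0.
by move=> ? ?; field; apply/andP.
Qed.

(** Taylor remainders of exp (t (a + i b)). The sums stop before degree n, so the remainders are of
    order t^n. *)
Definition rem_re n t := expR (t * a) * cos (t * b) - (cexp_re n).[t].
Definition rem_im n t := expR (t * a) * sin (t * b) - (cexp_im n).[t].

Lemma is_derive_rem_re n t :
  is_derive t (1 : R) (rem_re n.+1) (a * rem_re n t - b * rem_im n t).
Proof.
have de := is_derive1_comp (g := *%R^~ _)
  (is_derive_expR (t * a)) (is_derive_mulr _ a t).
have dc := is_derive1_comp (g := *%R^~ _)
  (is_derive_cos (t * b)) (is_derive_mulr _ b t).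
have H := is_deriveB (is_deriveM de dc) (is_derive_poly (cexp_re n.+1) t).
apply: (is_derive_eq H); rewrite deriv_cexp_re /rem_re /rem_im !hornerE /=.
rewrite /GRing.scale /=; ring.
Qed.

Lemma is_derive_rem_im n t :
  is_derive t (1 : R) (rem_im n.+1) (b * rem_re n t + a * rem_im n t).
Proof.
have de := is_derive1_comp (g := *%R^~ _)
  (is_derive_expR (t * a)) (is_derive_mulr _ a t).
have dc := is_derive1_comp (g := *%R^~ _)
  (is_derive_sin (t * b)) (is_derive_mulr _ b t).
have H := is_deriveB (is_deriveM de dc) (is_derive_poly (cexp_im n.+1) t).
apply: (is_derive_eq H); rewrite deriv_cexp_im /rem_re /rem_im !hornerE /=.
rewrite /GRing.scale /=; ring.
Qed.

(** The two bounds go by a joint induction because each derivative mixes both remainders. The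
    constant exp |a| dominates exp (t a) on [0, 1], and each integration costs a factor |a| +
    |b|. *)
Lemma norm_rem_le n t : 0 <= t <= 1 ->
  `|rem_re n t| <= expR `|a| * (`|a| + `|b|) ^+ n * t ^+ n / n`!%:R /\
  `|rem_im n t| <= expR `|a| * (`|a| + `|b|) ^+ n * t ^+ n / n`!%:R.
Proof.
elim: n t => [|n IH] t t01.
  (* For n = 0 the partial sum is empty and the remainder is the exponential itself. *)
  rewrite fact0 divr1 !expr0 !mulr1 /rem_re /rem_im /cexp_re /cexp_im.
  rewrite !poly_def !big_ord0 !horner0 !subr0 !normrM (ger0_norm (expR_ge0 _)).
  have eta : expR (t * a) <= expR `|a|.
    rewrite ler_expR; apply: le_trans (ler_norm _) _; rewrite normrM.
    by case/andP: t01 => t0 t1; rewrite ler_piMl// ger0_norm.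
  split; rewrite -[leRHS]mulr1; apply: ler_pM; rewrite ?expR_ge0 ?normr_ge0//.
    by rewrite ler_norml cos_geN1 cos_le1.
  by rewrite ler_norml sin_geN1 sin_le1.
have comb (u v s : R)
      (K := expR `|a| * (`|a| + `|b|) ^+ n * s ^+ n / n`!%:R) :
    `|u| <= K -> `|v| <= K ->
    `|a| * `|u| + `|b| * `|v| <=
    expR `|a| * (`|a| + `|b|) ^+ n.+1 * s ^+ n / n`!%:R.
  move=> uK vK; rewrite [leRHS](_ : _ = `|a| * K + `|b| * K).
    by rewrite lerD// ler_wpM2l.
  by rewrite /K exprS; ring.
split.
- apply: (@norm_le_of_derive_le_monomial R (rem_re n.+1)
    (fun t => a * rem_re n t - b * rem_im n t)) => //.
  + rewrite /rem_re !mul0r expR0 cos0 mulr1 horner_coef0 coef_poly /= fact0.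
    by rewrite divr1 subrr.
  + by move=> s; apply: is_derive_rem_re.
  + move=> s /IH[h1 h2]; apply: le_trans (ler_normB _ _) _.
    by rewrite !normrM comb.
- apply: (@norm_le_of_derive_le_monomial R (rem_im n.+1)
    (fun t => b * rem_re n t + a * rem_im n t)) => //.
  + rewrite /rem_im !mul0r expR0 sin0 mulr0 horner_coef0 coef_poly /=.
    by rewrite mul0r subrr.
  + by move=> s; apply: is_derive_rem_im.
  + move=> s /IH[h1 h2]; apply: le_trans (ler_normD _ _) _.
    by rewrite !normrM addrC comb.
Qed.

(** At t = 1 the bound is a constant times the general term of the series of exp (|a| + |b|). *)
Lemma cvg_rem_bound :
  expR `|a| * (`|a| + `|b|) ^+ n * 1 ^+ n / n`!%:R @[n --> \oo] --> (0 : R).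
Proof.
rewrite -(mulr0 (expR `|a|)).
rewrite [X in X @ _ --> _](_ : _ =
    (fun n => expR `|a| * exp_coeff (`|a| + `|b|) n)).
  by apply: cvgMr; exact: cvg_exp_coeff.
by apply/funext => n; rewrite expr1n mulr1 -mulrA.
Qed.

Lemma cvg_cexp_re : (cexp_re n).[1] @[n --> \oo] --> expR a * cos b.
Proof.
have -> : (fun n => (cexp_re n).[1]) =
    (fun n => expR a * cos b - rem_re n 1).
  by apply/funext => n; rewrite /rem_re !mul1r; ring.
rewrite -[X in _ --> X]subr0; apply: cvgB; first exact: cvg_cst.
have near_le : \forall n \near \oo, 0 <= `|rem_re n 1| <=
    expR `|a| * (`|a| + `|b|) ^+ n * 1 ^+ n / n`!%:R.
  apply: nearW => n; rewrite normr_ge0 /=.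
  by have [] := @norm_rem_le n 1; rewrite ?ler01 ?lexx.
exact: norm_cvg0 (squeeze_cvgr near_le (cvg_cst 0) cvg_rem_bound).
Qed.

Lemma cvg_cexp_im : (cexp_im n).[1] @[n --> \oo] --> expR a * sin b.
Proof.
have -> : (fun n => (cexp_im n).[1]) =
    (fun n => expR a * sin b - rem_im n 1).
  by apply/funext => n; rewrite /rem_im !mul1r; ring.
rewrite -[X in _ --> X]subr0; apply: cvgB; first exact: cvg_cst.
have near_le : \forall n \near \oo, 0 <= `|rem_im n 1| <=
    expR `|a| * (`|a| + `|b|) ^+ n * 1 ^+ n / n`!%:R.
  apply: nearW => n; rewrite normr_ge0 /=.
  by have [] := @norm_rem_le n 1; rewrite ?ler01 ?lexx.
exact: norm_cvg0 (squeeze_cvgr near_le (cvg_cst 0) cvg_rem_bound).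
Qed.

(** Powers stay in C_J, so the partial sums do too, and the limit is taken in the two real
    coordinates along 1 and J. *)
Lemma qexp_slice (J : quat R) : imaginary_units J ->
  qexp (slice J (a, b)) = slice J (expR a * cos b, expR a * sin b).
Proof.
move=> J2.
have powE n : slice J (a, b) ^+ n = slice J (cpow n).
  elim: n => [|n IH]; first by rewrite /slice /= scale1r scale0r addr0.
  by rewrite exprS IH slice_mul.
rewrite /qexp.
rewrite [X in limn X](_ : _ =
    (fun n => (cexp_re n).[1]%:A + (cexp_im n).[1] *: J)); last first.
  apply/funext => n; rewrite /series /= big_mkord !horner_poly.
  rewrite !scaler_suml -big_split /=; apply: eq_bigr => k _.
  by rewrite powE /slice scalerDr !scalerA expr1n !mulr1 ![_^-1 * _]mulrC.
apply: cvg_lim; first exact: norm_hausdorff.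
apply: cvgD; apply: cvgZr_tmp; [exact: cvg_cexp_re|exact: cvg_cexp_im].
Qed.

End ComplexExponentialSeries.

(** * Differentials of products and coordinate maps *)

Lemma is_diff_scale_fun (R : realType) (U V : normedModType R)
    (k dk : U -> R) (f df : U -> V) (x : U) :
  is_diff x k dk -> is_diff x f df ->
  is_diff x (fun y => k y *: f y) (fun v => k x *: df v + dk v *: f x).
Proof.
move=> dkx dfx.
(* Scaling is a continuous bilinear map, so its differential is known; composing with the pair of
   [k] and [f] gives the product rule. *)
have scb : bilinear_for
    (GRing.Scale.Law.clone _ _ *:%R _) (GRing.Scale.Law.clone _ _ *:%R _)
    (@GRing.scale R V : R -> V -> V).
  split=> [v|c] a y z /=; first by rewrite scalerDl scalerA.
  by rewrite scalerDr !scalerA mulrC.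
pose sb := bilinear_isBilinear.Build R R V V _ _ (@GRing.scale R V) scb.
pose s : {bilinear R -> V -> V} := HB.pack (@GRing.scale R V : R -> V -> V) sb.
have sc : continuous (fun p : R * V => s p.1 p.2) by exact: scale_continuous.
have ds : is_diff (k x, f x) (fun p : R * V => s p.1 p.2)
    (fun p => s (k x) p.2 + s p.1 (f x)).
  apply: DiffDef; first exact: differentiable_bilin.
  by rewrite diff_bilin.
exact: (is_diff_comp (is_diff_pair dkx dfx) ds).
Qed.

Lemma is_diff_fst (R : realType) (p : R * R) :
  is_diff p (fst : R * R -> R) (fst : R * R -> R).
Proof.
have lf : linear (fst : R * R -> R) by [].
pose lM := GRing.isLinear.Build _ _ _ _ _ lf.
pose l : {linear (R * R)%type -> R} := HB.pack (fst : R * R -> R) lM.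
have lc : continuous (l : R * R -> R) by move=> x; exact: cvg_fst.
apply: DiffDef; first exact: (linear_differentiable _ lc).
exact: (diff_lin _ lc).
Qed.

Lemma is_diff_snd (R : realType) (p : R * R) :
  is_diff p (snd : R * R -> R) (snd : R * R -> R).
Proof.
have lf : linear (snd : R * R -> R) by [].
pose lM := GRing.isLinear.Build _ _ _ _ _ lf.
pose l : {linear (R * R)%type -> R} := HB.pack (snd : R * R -> R) lM.
have lc : continuous (l : R * R -> R) by move=> x; exact: cvg_snd.
apply: DiffDef; first exact: (linear_differentiable _ lc).
exact: (diff_lin _ lc).
Qed.

(** Lets exp, cos and sin enter the chain rule for functions on the plane. *)
Lemma is_derive_diff (R : realType) (f : R -> R) (x d : R) :
  is_derive x (1 : R) f d -> is_diff x f ( *%R^~ d).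
Proof.
case=> df <-; apply: DiffDef; first exact/derivable1_diffP.
by rewrite deriv1E // derive1E.
Qed.

(** * The factor exp (c z^2) in real coordinates *)

Section GaussianFactor.
Variables (R : realType) (c : R).

(* Components of exp (c z^2) at z = x + I y. *)
Definition gauss_re (p : R * R) : R :=
  expR (c * (p.1 * p.1 - p.2 * p.2)) * cos (c * (p.1 * p.2 + p.2 * p.1)).
Definition gauss_im (p : R * R) : R :=
  expR (c * (p.1 * p.1 - p.2 * p.2)) * sin (c * (p.1 * p.2 + p.2 * p.1)).

(** Real and imaginary parts of d(c z^2) = 2 c z dz. *)
Let du (p v : R * R) : R := 2 * c * (p.1 * v.1 - p.2 * v.2).
Let dw (p v : R * R) : R := 2 * c * (p.1 * v.2 + p.2 * v.1).

Let is_diff_u (p : R * R) :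
  is_diff p (fun p : R * R => c * (p.1 * p.1 - p.2 * p.2)) (du p).
Proof.
have d1 := is_diff_fst R p; have d2 := is_diff_snd R p.
have H := is_diffZ c (is_diffB (is_diffM d1 d1) (is_diffM d2 d2)).
apply: (is_diff_eq H); apply/funext => v.
by rewrite !fctE /du /GRing.scale /=; ring.
Qed.

Let is_diff_w (p : R * R) :
  is_diff p (fun p : R * R => c * (p.1 * p.2 + p.2 * p.1)) (dw p).
Proof.
have d1 := is_diff_fst R p; have d2 := is_diff_snd R p.
have H := is_diffZ c (is_diffD (is_diffM d1 d2) (is_diffM d2 d1)).
apply: (is_diff_eq H); apply/funext => v.
by rewrite !fctE /dw /GRing.scale /=; ring.
Qed.

(** Real part of d exp (c z^2) = exp (c z^2) 2 c z dz. *)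
Lemma is_diff_gauss_re p :
  is_diff p gauss_re
    (fun v => gauss_re p * (2 * c * (p.1 * v.1 - p.2 * v.2))
              - gauss_im p * (2 * c * (p.1 * v.2 + p.2 * v.1))).
Proof.
have de := is_diff_comp (is_diff_u p)
  (is_derive_diff _ _ _ _ (is_derive_expR _)).
have dc := is_diff_comp (is_diff_w p)
  (is_derive_diff _ _ _ _ (is_derive_cos _)).
apply: (is_diff_eq (is_diffM de dc)); apply/funext => v.
by rewrite !fctE /gauss_re /gauss_im /du /dw /GRing.scale /=; ring.
Qed.

Lemma is_diff_gauss_im p :
  is_diff p gauss_im
    (fun v => gauss_im p * (2 * c * (p.1 * v.1 - p.2 * v.2))
              + gauss_re p * (2 * c * (p.1 * v.2 + p.2 * v.1))).
Proof.
have de := is_diff_comp (is_diff_u p)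
  (is_derive_diff _ _ _ _ (is_derive_expR _)).
have dc := is_diff_comp (is_diff_w p)
  (is_derive_diff _ _ _ _ (is_derive_sin _)).
apply: (is_diff_eq (is_diffM de dc)); apply/funext => v.
by rewrite !fctE /gauss_re /gauss_im /du /dw /GRing.scale /=; ring.
Qed.

Lemma gauss_reN x y : gauss_re (x, - y) = gauss_re (x, y).
Proof.
by rewrite /gauss_re /= !(mulrN, mulNr) opprK -opprD mulrN cosN.
Qed.

Lemma gauss_imN x y : gauss_im (x, - y) = - gauss_im (x, y).
Proof.
by rewrite /gauss_im /= !(mulrN, mulNr) opprK -opprD mulrN sinN mulrN.
Qed.

End GaussianFactor.

(** * Moduli, slices and weights *)

Section QuaternionSlices.
Variable R : realType.
Implicit Types (p q J f g : quat R) (s t : R * R).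

Lemma normqE q : `|q| ^+ 2 = qre q ^+ 2 + qi q ^+ 2 + qj q ^+ 2 + qk q ^+ 2.
Proof.
by rewrite /Num.norm /= /qmodulus sqr_sqrtr// !addr_ge0 ?sqr_ge0.
Qed.

Lemma normqM p q : `|p * q| ^+ 2 = `|p| ^+ 2 * `|q| ^+ 2.
Proof. by rewrite !normqE /=; ring. Qed.

(** Conjugation reverses products, and the inner factor [qconj p * p] is the real number |p|^2,
    hence central. *)
Lemma qconjM_normq p f g :
  qconj (p * g) * (p * f) = `|p| ^+ 2 *: (qconj g * f).
Proof. by rewrite normqE; congr Quat => /=; ring. Qed.

Lemma imaginary_unitP J : imaginary_units J ->
  qre J = 0 /\ qi J ^+ 2 + qj J ^+ 2 + qk J ^+ 2 = 1.
Proof.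
case: J => a x y z J2 /=.
have [h0 h1 h2 h3] : [/\ a * a - x * x - y * y - z * z = -1,
    2 * a * x = 0, 2 * a * y = 0 & 2 * a * z = 0].
  have := J2; rewrite /imaginary_units /= expr2 => -[h0 h1 h2 h3].
  by rewrite oppr0 in h1 h2 h3; split; lra.
(* A nonzero real part would force the imaginary part to vanish, leaving a^2 = -1. *)
have [a0|a0] := eqVneq a 0; first by split=> //; rewrite a0 in h0; lra.
have cancel_a v : 2 * a * v = 0 -> v = 0.
  by move=> /eqP; rewrite !mulf_eq0 pnatr_eq0 (negbTE a0) => /eqP.
have := sqr_ge0 a.
rewrite (cancel_a _ h1) (cancel_a _ h2) (cancel_a _ h3) in h0.
by rewrite expr2; lra.
Qed.

Lemma slice_surj q : exists J s, imaginary_units J /\ q = slice J s.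
Proof.
case: q => a x y z.
pose n := Num.sqrt (x ^+ 2 + y ^+ 2 + z ^+ 2).
have n2 : n ^+ 2 = x ^+ 2 + y ^+ 2 + z ^+ 2.
  by rewrite sqr_sqrtr// !addr_ge0 ?sqr_ge0.
(* A real quaternion lies in every C_J, and i is chosen; otherwise J is the normalised imaginary
   part. *)
have [n0|n0] := eqVneq n 0.
  exists (Quat 0 1 0 0), (a, 0); split.
    by rewrite /imaginary_units /= expr2; congr Quat => /=; ring.
  move: n2; rewrite n0 expr0n /= => n2.
  have hx := sqr_ge0 x; have hy := sqr_ge0 y; have hz := sqr_ge0 z.
  have [x0 y0 z0] : [/\ x = 0, y = 0 & z = 0].
    by split; apply/eqP; rewrite -sqrf_eq0; apply/eqP; lra.
  by rewrite x0 y0 z0 /slice; congr Quat => /=; ring.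
exists (Quat 0 (x / n) (y / n) (z / n)), (a, n); split.
  rewrite /imaginary_units /= expr2; congr Quat => /=; try ring.
  rewrite (_ : _ - _ = - ((x ^+ 2 + y ^+ 2 + z ^+ 2) / n ^+ 2)).
    by rewrite -n2 divff// expf_neq0.
  by field.
by rewrite /slice; congr Quat => /=; field.
Qed.

Lemma norm_slice J s : imaginary_units J ->
  `|slice J s| ^+ 2 = s.1 ^+ 2 + s.2 ^+ 2.
Proof.
move=> /imaginary_unitP[J0 J1]; rewrite normqE /slice /= J0.
rewrite [in RHS](_ : s.2 ^+ 2 =
  s.2 ^+ 2 * (qi J ^+ 2 + qj J ^+ 2 + qk J ^+ 2)); first ring.
by rewrite J1 mulr1.
Qed.

Lemma qexp_sqr_slice (c : R) J s : imaginary_units J ->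
  qexp (c *: slice J s ^+ 2) = slice J (gauss_re R c s, gauss_im R c s).
Proof. by move=> Ju; rewrite expr2 slice_mul// scale_slice qexp_slice. Qed.

(** Both exponentials lie in one plane C_J containing q, where the closed form reduces the claim to
    complex numbers. *)
Lemma qexp_sqrNK (c : R) q : qexp (- (c *: q ^+ 2)) * qexp (c *: q ^+ 2) = 1.
Proof.
have [J [s [Ju ->]]] := slice_surj q.
rewrite -scaleNr !qexp_sqr_slice// slice_mul// /gauss_re /gauss_im.
rewrite !mulNr cosN sinN expRN /=.
set u := c * _; set w := c * _.
have e0 : expR u != 0 by rewrite gt_eqF ?expR_gt0.
rewrite (_ : _ - _ = 1); last first.
  by rewrite -(cos2Dsin2 w); field.
rewrite (_ : _ + _ = 0); last by field.
by rewrite /slice /= scale1r scale0r addr0.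
Qed.

Lemma qexp_sqrKN (c : R) q : qexp (c *: q ^+ 2) * qexp (- (c *: q ^+ 2)) = 1.
Proof. by have := qexp_sqrNK (- c) q; rewrite scaleNr opprK. Qed.

Lemma normq_qexp_sqr (c : R) J s : imaginary_units J ->
  `|qexp (c *: slice J s ^+ 2)| ^+ 2 = expR (2 * c * (s.1 ^+ 2 - s.2 ^+ 2)).
Proof.
move=> Ju; rewrite qexp_sqr_slice// norm_slice// /gauss_re /gauss_im /=.
rewrite !exprMn -mulrDr cos2Dsin2 mulr1 -expRM_natl; congr expR.
by rewrite -mulr_natl; ring.
Qed.

Lemma rbf_weight_slice (gamma : R) J s : imaginary_units J ->
  rbf_weight gamma (slice J s) = expR (- 4 * (gamma ^+ 2)^-1 * s.2 ^+ 2).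
Proof.
move=> Ju; have [J0 _] := imaginary_unitP J Ju.
(* The difference is 2 y J, whose square is the real number - 4 y^2. *)
have im2 : slice J s - qconj (slice J s) = slice J (0, 2 * s.2).
  by rewrite /slice; congr Quat => /=; rewrite ?J0; ring.
rewrite /rbf_weight im2 [slice _ _ ^+ 2]expr2 slice_mul// scale_slice.
rewrite qexp_slice//=.
rewrite !mul0r mulr0 addr0 mulr0 cos0 sin0 mulr0 mulr1 /slice /= J0.
rewrite !mulr0 addr0 mulr1; congr expR; ring.
Qed.

(** The Fock parameter 2 / gamma^2 is the one for which the x^2 terms of the two exponents
    cancel. *)
Lemma rbf_weightE (gamma : R) J s : imaginary_units J ->
  rbf_weight gamma (slice J s) =
  `|qexp ((gamma ^+ 2)^-1 *: slice J s ^+ 2)| ^+ 2 *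
  fock_weight (2 / gamma ^+ 2) (slice J s).
Proof.
move=> Ju; rewrite rbf_weight_slice// normq_qexp_sqr// /fock_weight.
by rewrite norm_slice// -expRD; congr expR; ring.
Qed.

End QuaternionSlices.

(** * Multipliers preserving slice hyperholomorphy *)

Lemma differentiable_scale_fun (R : realType) (U V : normedModType R)
    (k : U -> R) (f : U -> V) (x : U) :
  differentiable k x -> differentiable f x ->
  differentiable (fun y => k y *: f y) x.
Proof.
move=> /differentiableP dk /differentiableP df.
by have [] := is_diff_scale_fun R U V k _ f _ x dk df.
Qed.

Lemma derive_scale_fun (R : realType) (U V : normedModType R)
    (k : U -> R) (f : U -> V) (x v : U) :
  differentiable k x -> differentiable f x ->
  'D_v (fun y => k y *: f y) x = k x *: 'D_v f x + 'D_v k x *: f x.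
Proof.
move=> dk df; rewrite !deriveE//; last exact: differentiable_scale_fun.
have [_ ->] := is_diff_scale_fun R U V k _ f _ x
  (differentiableP dk) (differentiableP df).
by [].
Qed.

(** Real [A] and [B] commute with J, so (A + J B)(alpha + J beta) splits as in the complex case. For
    general quaternionic components this splitting would fail. *)
Lemma slice_hyperholomorphic_mul (R : realType) (A B : R * R -> R)
    (E f : quat R -> quat R) :
  (forall J, imaginary_units J ->
    forall p, E (slice J p) = slice J (A p, B p)) ->
  (forall x y, A (x, - y) = A (x, y)) ->
  (forall x y, B (x, - y) = - B (x, y)) ->
  (forall p, differentiable A p /\ differentiable B p) ->
  (forall p, 'D_(1, 0) A p = 'D_(0, 1) B p /\
             'D_(0, 1) A p = - 'D_(1, 0) B p) ->
  slice_hyperholomorphic f ->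
  slice_hyperholomorphic (fun q => E q * f q).
Proof.
move=> EE AN BN dAB CRE [al [be [fE alN beN dab CR]]].
exists (fun p => A p *: al p - B p *: be p),
  (fun p => A p *: be p + B p *: al p).
have dsc := differentiable_scale_fun R (R * R)%type (quat R).
split.
- move=> J Ju p; rewrite fE// EE// /slice /=.
  rewrite mulrDl !mulrDr -!scalerAl -!scalerAr !mul1r mulrA -expr2 Ju mulN1r.
  rewrite scalerN -!addrA; congr (_ + _).
  by rewrite addrA addrC.
- by move=> x y; rewrite AN BN alN beN scaleNr scalerN opprK.
- by move=> x y; rewrite AN BN alN beN scaleNr scalerN opprD.
- move=> p; have [dA dB] := dAB p; have [da db] := dab p.
  by split; [apply: differentiableB|apply: differentiableD]; apply: dsc.
- move=> p; have [dA dB] := dAB p; have [da db] := dab p.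
  have DB v : 'D_v (fun p => A p *: al p - B p *: be p) p =
      A p *: 'D_v al p + 'D_v A p *: al p
      - (B p *: 'D_v be p + 'D_v B p *: be p).
    rewrite -!derive_scale_fun//; apply: deriveB;
    by apply: diff_derivable; apply: dsc.
  have DD v : 'D_v (fun p => A p *: be p + B p *: al p) p =
      A p *: 'D_v be p + 'D_v A p *: be p
      + (B p *: 'D_v al p + 'D_v B p *: al p).
    rewrite -!derive_scale_fun//; apply: deriveD;
    by apply: diff_derivable; apply: dsc.
  (* The Cauchy-Riemann equations of both factors eliminate the derivatives of [A] and [al]; the
     remaining terms cancel. *)
  rewrite !DB !DD; have [-> ->] := CRE p.
  have [/eqP + /eqP] := CR p; rewrite subr_eq0 addr_eq0 => /eqP -> /eqP ->.
  move: ('D_(0, 1) be p) ('D_(1, 0) be p) (al p) (be p) => [????] [????].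
  by move=> [????] [????]; split; congr Quat => /=; ring.
Qed.

Lemma slice_hyperholomorphic_qexp_sqr (R : realType) (c : R)
    (f : quat R -> quat R) :
  slice_hyperholomorphic f ->
  slice_hyperholomorphic (fun q => qexp (c *: q ^+ 2) * f q).
Proof.
apply: (@slice_hyperholomorphic_mul _ (gauss_re R c) (gauss_im R c)).
- by move=> J Ju p; exact: qexp_sqr_slice.
- exact: gauss_reN.
- exact: gauss_imN.
- by move=> p; have [? _] := is_diff_gauss_re R c p;
    have [? _] := is_diff_gauss_im R c p.
- move=> p; have [dA dAE] := is_diff_gauss_re R c p.
  have [dB dBE] := is_diff_gauss_im R c p.
  (* The partial derivatives are the differentials evaluated at (1, 0) and (0, 1). *)
  rewrite !(deriveE _ dA) !(deriveE _ dB) dAE dBE /=.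
  by split; ring.
Qed.

(** * The multiplication operator between the two spaces *)

Section RbfMultiplication.
Variables (R : realType) (gamma : R) (I : quat R).
Implicit Types hI : imaginary_units I.
Implicit Types f g : quat R -> quat R.

(** The right side is the Fock constant nu / pi at nu = 2 / gamma^2. *)
Let constE : rbf_const gamma = 2 / gamma ^+ 2 / pi.
Proof.
by rewrite /rbf_const invfM mulrA mulrAC.
Qed.

Lemma slice_norm2_rbf_mult hI f :
  slice_norm2 (2 / gamma ^+ 2 / pi) (fock_weight (2 / gamma ^+ 2)) I
    (rbf_mult gamma f) =
  slice_norm2 (rbf_const gamma) (rbf_weight gamma) I f.
Proof.
rewrite /slice_norm2 constE; congr (_ * _)%E; apply: eq_integral => p _.
congr EFin; rewrite /rbf_mult normqM rbf_weightE//; ring.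
Qed.

Lemma fock_inner_rbf_mult hI f g :
  fock_inner (2 / gamma ^+ 2) I (rbf_mult gamma f) (rbf_mult gamma g) =
  rbf_inner gamma I f g.
Proof.
rewrite /fock_inner /rbf_inner /slice_inner constE; congr (_ *: qintegral _).
apply/funext => p.
by rewrite /rbf_mult qconjM_normq scalerA rbf_weightE// mulrC.
Qed.

Lemma slice_hyperholomorphic_rbf_mult f :
  slice_hyperholomorphic (rbf_mult gamma f) <-> slice_hyperholomorphic f.
Proof.
split; last exact: slice_hyperholomorphic_qexp_sqr.
move=> /(slice_hyperholomorphic_qexp_sqr _ (- (gamma ^+ 2)^-1)).
rewrite (_ : (fun q => _) = f) //; apply/funext => q.
by rewrite /rbf_mult mulrA scaleNr qexp_sqrNK mul1r.
Qed.

Lemma fock_space_rbf_mult hI f :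
  fock_space (2 / gamma ^+ 2) I (rbf_mult gamma f) <-> rbf_space gamma I f.
Proof.
by rewrite /fock_space /rbf_space /slice_space /= slice_norm2_rbf_mult//
  slice_hyperholomorphic_rbf_mult.
Qed.

(** The two exponentials are mutually inverse. This gives existence and uniqueness of g, and
    bijectivity of the operator. *)
Lemma rbf_mult_eq f g :
  (forall q, f q = qexp (- ((gamma ^+ 2)^-1 *: q ^+ 2)) * g q) <->
  rbf_mult gamma f = g.
Proof.
split=> [fg|<- q]; last by rewrite /rbf_mult mulrA qexp_sqrNK mul1r.
by apply/funext => q; rewrite /rbf_mult fg mulrA qexp_sqrKN mul1r.
Qed.

End RbfMultiplication.

Theorem theorem2p7 (R : realType) (gamma : R) (hgamma : 0 < gamma)
    (I : quat R) (hI : imaginary_units I) :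
  (forall f : quat R -> quat R, slice_hyperholomorphic f ->
     (rbf_space gamma I f <->
      exists! g : quat R -> quat R,
        fock_space (2 / gamma ^+ 2) I g /\
        forall q, f q = qexp (- ((gamma ^+ 2)^-1 *: q ^+ 2)) * g q)) /\
  isometric_isomorphism
    (rbf_space gamma I) (fock_space (2 / gamma ^+ 2) I)
    (rbf_norm gamma I) (fock_norm (2 / gamma ^+ 2) I)
    (rbf_inner gamma I) (fock_inner (2 / gamma ^+ 2) I)
    (rbf_mult gamma).
Proof.
split.
  move=> f _; split=> [ff|[g [[gF /rbf_mult_eq fg] _]]]; last first.
    by apply/fock_space_rbf_mult => //; rewrite fg.
  exists (rbf_mult gamma f); split; last by move=> g [_ /rbf_mult_eq].
  by split; [apply/fock_space_rbf_mult|apply/rbf_mult_eq].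
split.
- split.
  + by move=> f ff; apply/fock_space_rbf_mult.
  + move=> f g _ _ fg; apply/funext => q.
    by rewrite ((rbf_mult_eq _ _ _ _).2 fg q)
      -((rbf_mult_eq _ _ g _).2 erefl q).
  + move=> g gF.
    pose f (q : quat R) := qexp (- ((gamma ^+ 2)^-1 *: q ^+ 2)) * g q.
    have fg : rbf_mult gamma f = g by apply/rbf_mult_eq.
    have [+ _] := fock_space_rbf_mult _ gamma _ hI f; rewrite fg => /(_ gF) ff.
    exact: ex_intro2 ff fg.
- by move=> f g _ _; apply/funext => q; rewrite /rbf_mult mulrDr.
(* Scalars act on the right and the exponential on the left, so associativity suffices. *)
- by move=> f a _; apply/funext => q; rewrite /rbf_mult mulrA.
- by move=> f _; rewrite /fock_norm /slice_norm slice_norm2_rbf_mult.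
- by move=> f g _ _; apply: fock_inner_rbf_mult.
Qed.
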